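(* Let $G$ be a profinite group. For every commutative ring $R$ with identity and every open subgroup $U$ of $G$: (a) $\mathrm{Ind}_U^G(R)\circ\tau_R^U=\tau_R^G\circ v_U$; (b) $\mathbf{Ind}_U^G(R)\circ\theta_R^U=\theta_R^G\circ\mathrm{Ind}_U^G(R)$; (c) $\mathbf{Ind}_U^G(R)\circ\gamma_R^U=\gamma_R^G\circ v_U$.
   Context: Conventions. All rings are commutative, associative, with $1\neq 0$. $G$ is a profinite group; $U,V,W$ denote open subgroups; $\mathcal O(G)$ is the set of open subgroups of $G$. $U\lesssim V$ means that $U$ is contained in a $G$-conjugate of $V$, and then $(V:U)$ denotes the index of $U$ in such a conjugate. $\varphi_U(G/V)$ is the number of $U$-fixed points of $G/V$. A prime on $\sum$ or $\prod$ means that exactly one open subgroup from each conjugacy class is taken. $Z(g,V,W):=V\cap gWg^{-1}$. The same notation is used for an open subgroup $U$ of $G$ regarded as a profinite group (with $U$-conjugacy classes). $W_G$ (Dress-Siebeneicher) is the unique functor from commutative rings to commutative rings such that: as a set $W_G(A)$ is the set of maps $\mathcal O(G)\to A$ constant on conjugacy classes; $W_G(h)(\alpha)=h\circ\alpha$; and for every open $V$ the map $\phi_V^{A,G}:W_G(A)\to A$, $\alpha\mapsto\sum'_{V\lesssim W\leqslant G}\varphi_V(G/W)\,\alpha(W)^{(W:V)}$, is a ring homomorphism, natural in $A$. For an ideal $I$ of $A$, $W_G(I)$ denotes the set of $\alpha\in W_G(A)$ with all values in $I$. The induction $v_U:W_U(A)\to W_G(A)$ is the unique family of maps, natural in the ring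 $A$, with $\phi_V^{A,G}(v_U(\alpha))=\sum_{gU\in (G/U)^V}\phi^{A,U}_{g^{-1}Vg}(\alpha)$ for all open $V\leqslant G$ (sum over the $V$-fixed points of $G/U$); it is additive and given by universal integral polynomials. Rings $\Delta_G(R)$, $\mathcal{AP}_G(R)$ and maps. Case 1: $R\supseteq\mathbb Q$. $\Delta_G(R)$ is the set $\prod'_{V\leqslant G}R$ with componentwise addition and multiplication $(\mathbf x\mathbf y)_U=\sum'_{V,W}p_V^W(U)x_Vy_W$, where $p_V^W(U)$ is the number of double cosets $VgW\subseteq G$ with $Z(g,V,W)$ conjugate to $U$ in $G$. $\mathcal{AP}_G(R)$ is the same additive group with multiplication $(\mathbf x\mathbf y)_U=\sum'_{V,W}\sum_g\frac{(G:Z(g,V,W))}{(G:V)(G:W)}x_Vy_W$, where $g$ runs over representatives of the double cosets $VgW$ with $Z(g,V,W)$ conjugate to $U$. For $r\in R$, $(M_G(r,V))'_V$ is the unique family with $\sum'_{U\lesssim V\leqslant G}\varphi_U(G/V)M_G(r,V)=r^{(G:U)}$ for all open $U\leqslant G$; $\tau^G(R)(r):=(M_G(r,V))'_V$, and similarly $\tau^U(R):R\to\Delta_U(R)$. $\mathrm{Ind}_U^G(R):\Delta_U(R)\to\Delta_G(R)$ sends $(x_V)'_{V\leqslant U}$ to $(y_W)'_{W\leqslant G}$, where $y_W$ is the sum of those $x_V$ (one per $U$-conjugacy class) with $V$ conjugate to $W$ in $G$. $\mathbf{Ind}_U^G(R):\mathcal{AP}_U(R)\to\mathcal{AP}_G(R)$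 is defined likewise with $y_W$ the sum of the $(G:U)x_V$. $\tau_R^G(\alpha):=\sum'_{U\leqslant G}\mathrm{Ind}_U^G(R)(\tau^U(R)(\alpha(U)))$, $\theta_R^G((x_V)'_V):=((G:V)x_V)'_V$. Case 2: $R$ torsion-free, not containing $\mathbb Q$. With $R\mathbb Q=R\otimes_{\mathbb Z}\mathbb Q$: $\Delta_G(R):=\tau^G_{R\mathbb Q}(W_G(R))\subset\Delta_G(R\mathbb Q)$, $\mathcal{AP}_G(R):=\theta_{R\mathbb Q}^G(\Delta_G(R))\subset\mathcal{AP}_G(R\mathbb Q)$, and $\tau_R^G,\theta_R^G,\mathrm{Ind}_U^G(R),\mathbf{Ind}_U^G(R)$ are the restrictions of the corresponding maps for $R\mathbb Q$ (which do restrict). Case 3: $R$ not torsion-free. Choose a surjective ring homomorphism $\rho:R'\to R$ with $R'$ torsion-free (e.g. $R'=\mathbb Z[R]$, with $\mathbb Z$-basis $e_r$, $e_re_s=e_{rs}$, $\rho(e_r)=r$). Put $\Delta_G(\ker\rho)=\tau_{R'}^G(W_G(\ker\rho))$, $\mathcal{AP}_G(\ker\rho)=\theta_{R'}^G(\Delta_G(\ker\rho))$, $\Delta_G(R)=\Delta_G(R')/\Delta_G(\ker\rho)$, $\mathcal{AP}_G(R)=\mathcal{AP}_G(R')/\mathcal{AP}_G(\ker\rho)$, and let $\tau_R^G$ (on $W_G(R)=W_G(R')/W_G(\ker\rho)$), $\theta_R^G$, $\mathrm{Ind}_U^G(R)$, $\mathbf{Ind}_U^G(R)$ be the maps induced by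 those of $R'$. In all cases $\gamma_R^G:=\theta_R^G\circ\tau_R^G:W_G(R)\to\mathcal{AP}_G(R)$. *)

(* Defs.v *)
From HB Require Import structures.
From mathcomp Require Import all_boot all_order all_algebra.
From mathcomp Require Import finmap.
From mathcomp Require Import boolp classical_sets functions cardinality fsbigop.
From mathcomp Require Import topology.

Set Implicit Arguments.
Unset Strict Implicit.
Unset Printing Implicit Defensive.

Import GRing.Theory.
Local Open Scope classical_set_scope.
Local Open Scope ring_scope.

HB.mixin Record isProfinite G of Group G & Topological G := {
  mulg_continuous : continuous (fun xy : G * G => (xy.1 * xy.2)%g);
  invg_continuous : continuous (fun x : G => x^-1%g);
  profinite_hausdorff : hausdorff_space G;
  profinite_compact : compact [set: G];
  profinite_totally_disconnected : totally_disconnected [set: G] }.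

#[short(type="profiniteGroupType")]
HB.structure Definition ProfiniteGroup :=
  { G of Group G & Topological G & isProfinite G }.

Section OpenSubgroups.
Variable G : profiniteGroupType.
Implicit Types H V W C : set G.

Definition conjset W (g : G) : set G := [set (w ^ g)%g | w in W].

(* [h] runs over all of [H], so conjugating by [h] or by [h^-1] is the same. *)
Definition conj_in H V W : Prop := exists2 h, H h & V = conjset W h.

Definition subconj_in H V W : Prop := exists2 h, H h & V `<=` conjset W h.

Definition lcosets H V : set (set G) :=
  [set [set (h * v)%g | v in V] | h in H].

Definition fixed_lcosets V H W : set (set G) :=
  [set C | lcosets H W C /\ forall v, V v -> [set (v * c)%g | c in C] = C].

(* [fset_set] is empty on infinite sets; cosets of open subgroups of a profinite
   group are finite in number. *)
Definition index H V : nat := #|` fset_set (lcosets H V)|%fset.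

Definition fixed_points V H W : nat := #|` fset_set (fixed_lcosets V H W)|%fset.

(* (W : V) when V is contained in an H-conjugate of W. *)
Definition conj_index H W V : nat :=
  index (conjset W (xget 1%g [set h | H h /\ V `<=` conjset W h])) V.

Record opensubgroup := OpenSubgroup {
  opensubgroup_set :> set G;
  opensubgroup_open : open opensubgroup_set;
  opensubgroup1 : opensubgroup_set 1%g;
  opensubgroupM : forall x y, opensubgroup_set x -> opensubgroup_set y ->
    opensubgroup_set (x * y)%g;
  opensubgroupV : forall x, opensubgroup_set x -> opensubgroup_set x^-1%g }.

Definition whole_group : opensubgroup :=
  @OpenSubgroup [set: G] openT I (fun _ _ _ _ => I) (fun _ _ => I).

End OpenSubgroups.

(* An open subgroup H, regarded as a profinite group, is not turned into a type
   of its own: its open subgroups are the open subgroups of G contained in H. *)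
Record osub (G : profiniteGroupType) (H : opensubgroup G) := OSub {
  osub_val :> opensubgroup G;
  osub_sub : osub_val `<=` H }.

HB.instance Definition _ G H := gen_eqMixin (@osub G H).
HB.instance Definition _ G H := gen_choiceMixin (@osub G H).

Definition class_repr (G : profiniteGroupType) (H : opensubgroup G)
  (V : osub H) : osub H := xget V [set W : osub H | conj_in H V W].

(* Exactly one open subgroup of H from each H-conjugacy class: the index type
   of the primed sums and products. *)
Record ocl (G : profiniteGroupType) (H : opensubgroup G) := OCl {
  ocl_val :> osub H;
  ocl_repr : class_repr ocl_val = ocl_val }.

HB.instance Definition _ G H := gen_eqMixin (@ocl G H).
HB.instance Definition _ G H := gen_choiceMixin (@ocl G H).

Section WittBurnside.
Variable G : profiniteGroupType.

Record cfun (H : opensubgroup G) (A : Type) := CFun {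
  cfun_val :> osub H -> A;
  cfun_conj : forall V W : osub H, conj_in H V W -> cfun_val V = cfun_val W }.

Definition cfun_map H A B (h : A -> B) (x : cfun H A) : cfun H B :=
  @CFun H B (fun V => h (x V)) (fun V W VW => congr1 h (cfun_conj x VW)).

Definition cfun_cst H A (a : A) : cfun H A :=
  @CFun H A (fun=> a) (fun _ _ _ => erefl).

(* The map phi_V. *)
Definition ghost H (A : comNzRingType) (V : set G) (x : cfun H A) : A :=
  \sum_(W \in [set W : ocl H | subconj_in H V W])
    x W ^+ conj_index H W V *+ fixed_points V H W.

Definition is_ring_hom (A B : pzRingType) (f : A -> B) : Prop :=
  zmod_morphism f /\ monoid_morphism f.

(* The functors W_H, for H an open subgroup of G: a commutative ring structure
   on each [cfun H A].  Naturality of [ghost V] in A is automatic.  By Dress and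
   Siebeneicher there is exactly one such structure. *)
Record wb_functor := WBFunctor {
  wb_class : forall (H : opensubgroup G) (A : comNzRingType),
    GRing.ComNzRing.axioms_ (cfun H A);
  wb_ring := fun H A => GRing.ComNzRing.Pack (wb_class H A);
  wb_map_hom : forall H (A B : comNzRingType) (h : {rmorphism A -> B}),
    @is_ring_hom (wb_ring H A) (wb_ring H B) (@cfun_map H A B h);
  wb_ghost_hom : forall H (V : osub H) (A : comNzRingType),
    @is_ring_hom (wb_ring H A) A (@ghost H A V) }.

Coercion wb_ring : wb_functor >-> Funclass.

(* The family of maps v_U, which is unique; [xget 1 C] is a g with C = gU. *)
Definition is_induction (W : wb_functor) (U : opensubgroup G)
    (v : forall A : comNzRingType, W U A -> W (whole_group G) A) : Prop :=
  (forall (A B : comNzRingType) (h : {rmorphism A -> B}) (x : cfun U A),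
     v B (cfun_map h x) = cfun_map h (v A x)) /\
  (forall (A : comNzRingType) (V : opensubgroup G) (x : cfun U A),
     ghost V (v A x) =
       \sum_(C \in fixed_lcosets V (whole_group G) U)
         ghost (conjset V (xget 1%g C)) x).

End WittBurnside.

Definition contains_rat (R : comNzRingType) : Prop :=
  inhabited {rmorphism rat -> R}.

Definition torsion_free (R : comNzRingType) : Prop :=
  forall (n : nat) (x : R), x *+ n.+1 = 0 -> x = 0.

(* [K], with [i], is the tensor product of R and rat over the integers, i.e.
   the coproduct of R and rat in commutative rings. *)
Definition is_tensor_rat (R K : comNzRingType) (i : {rmorphism R -> K}) : Prop :=
  exists j : {rmorphism rat -> K},
    forall (S : comNzRingType) (f : {rmorphism R -> S}) (g : {rmorphism rat -> S}),
      (exists h : {rmorphism K -> S}, h \o i =1 f /\ h \o j =1 g) /\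
      (forall h h' : {rmorphism K -> S},
         h \o i =1 h' \o i -> h \o j =1 h' \o j -> h =1 h').

(* The rings Delta_H(R) and AP_H(R) enter only through their elements and their
   additive groups; their multiplications play no role in the maps below. *)
Section OverQ.
Variables (G : profiniteGroupType) (K : comNzRingType).
Implicit Types H U : opensubgroup G.

(* When K contains rat there is exactly one such family. *)
Definition M_family H (r : K) : ocl H -> K :=
  xget (fun=> 0) [set M : ocl H -> K | forall U : osub H,
    \sum_(V \in [set V : ocl H | subconj_in H U V]) M V *+ fixed_points U H V
      = r ^+ index H U].
Arguments M_family : clear implicits.

Definition Ind_Q U H (x : ocl U -> K) : ocl H -> K :=
  fun W => \sum_(V \in [set V : ocl U | conj_in H V W]) x V.
Arguments Ind_Q : clear implicits.

Definition bInd_Q U H (x : ocl U -> K) : ocl H -> K :=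
  fun W => \sum_(V \in [set V : ocl U | conj_in H V W]) x V *+ index H U.
Arguments bInd_Q : clear implicits.

(* The sum over U is computed in each coordinate, where it is finite. *)
Definition tau_Q H (a : cfun H K) : ocl H -> K :=
  fun W => \sum_(U \in [set: ocl H]) Ind_Q U H (M_family U (a U)) W.

Definition theta_Q H (x : ocl H -> K) : ocl H -> K :=
  fun V => x V *+ index H V.

End OverQ.

Arguments M_family {G K} H r _.
Arguments Ind_Q {G K} U H x _.
Arguments bInd_Q {G K} U H x _.

Record necklace_data (G : profiniteGroupType) (W : wb_functor G)
    (R : comNzRingType) := NecklaceData {
  Delta : opensubgroup G -> Type;
  AP : opensubgroup G -> Type;
  tau : forall H, W H R -> Delta H;
  theta : forall H, Delta H -> AP H;
  Ind : forall U H, Delta U -> Delta H;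
  bInd : forall U H, AP U -> AP H }.

Arguments tau {G W R} n H _.
Arguments theta {G W R} n H _.
Arguments Ind {G W R} n U H _.
Arguments bInd {G W R} n U H _.

Definition gamma (G : profiniteGroupType) (W : wb_functor G) (R : comNzRingType)
  (D : necklace_data W R) H : W H R -> AP D H := theta D H \o tau D H.
Arguments gamma {G W R} D H _.

Section RationalCase.
Variables (G : profiniteGroupType) (W : wb_functor G) (R : comNzRingType).

Definition rational_data : necklace_data W R :=
  @NecklaceData G W R (fun H => ocl H -> R) (fun H => ocl H -> R)
    (@tau_Q G R) (@theta_Q G R) (@Ind_Q G R) (@bInd_Q G R).

End RationalCase.

Section TorsionFreeCase.
Variables (G : profiniteGroupType) (W : wb_functor G).
Variables (R K : comNzRingType) (i : {rmorphism R -> K}).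
Implicit Types H U : opensubgroup G.

Definition tau_incl H (a : W H R) : ocl H -> K := tau_Q (cfun_map i a).

Definition Delta_tf H : set (ocl H -> K) := range (@tau_incl H).
Arguments Delta_tf : clear implicits.

Definition AP_tf H : set (ocl H -> K) := @theta_Q G K H @` Delta_tf H.
Arguments AP_tf : clear implicits.

Definition tau_tf H (a : W H R) : Delta_tf H :=
  exist _ (tau_incl a) (mem_set (imageT (@tau_incl H) a)).

Definition theta_tf H (x : Delta_tf H) : AP_tf H :=
  exist _ (theta_Q (val x)) (mem_set (imageP (@theta_Q G K H) (set_valP x))).

(* The defaults of [insubd] are irrelevant, as the maps do restrict. *)
Definition Ind_tf U H (x : Delta_tf U) : Delta_tf H :=
  insubd (tau_tf (cfun_cst H 0)) (Ind_Q U H (val x)).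

Definition bInd_tf U H (x : AP_tf U) : AP_tf H :=
  insubd (theta_tf (tau_tf (cfun_cst H 0))) (bInd_Q U H (val x)).

Definition torsion_free_data : necklace_data W R :=
  @NecklaceData G W R Delta_tf AP_tf
    tau_tf theta_tf Ind_tf bInd_tf.

End TorsionFreeCase.

Arguments Delta_tf {G} W {R K} i H _.
Arguments AP_tf {G} W {R K} i H _.
Arguments tau_tf {G} W {R K} i {H} a.

(* Additive quotients: A is viewed as a subgroup of X -> K containing N. *)
Definition coset_mod (X : Type) (K : zmodType) (A N : set (X -> K)) (x : A) : set A :=
  [set y : A | exists2 n, N n & val y = val x \+ n].

Definition quotient_mod (X : Type) (K : zmodType) (A N : set (X -> K)) : set (set A) :=
  range (@coset_mod X K A N).
Arguments quotient_mod {X K} A N _.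

Definition pi_mod (X : Type) (K : zmodType) (A N : set (X -> K)) (x : A) :
    quotient_mod A N :=
  exist _ (coset_mod N x) (mem_set (imageT (@coset_mod X K A N) x)).

(* The map fb with fb \o p = q \o f, for p surjective and f compatible with p
   and q; d is then irrelevant. *)
Definition induced (X X' Y : Type) (Y' : choiceType) (d : Y')
    (p : X -> X') (q : Y -> Y') (f : X -> Y) (c : X') : Y' :=
  xget d [set y | forall x, p x = c -> y = q (f x)].

Section TorsionCase.
Variables (G : profiniteGroupType) (W : wb_functor G).
Variables (R R' K : comNzRingType).
Variables (rho : {rmorphism R' -> R}) (i : {rmorphism R' -> K}).
Implicit Types H U : opensubgroup G.

Definition wb_ideal (I : set R') H : set (W H R') :=
  [set a : cfun H R' | forall V, I (a V)].
Arguments wb_ideal : clear implicits.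

Definition ker_rho : set R' := [set a | rho a = 0].

Definition Delta_ker H : set (ocl H -> K) :=
  @tau_incl G W R' K i H @` wb_ideal ker_rho H.
Arguments Delta_ker : clear implicits.

Definition AP_ker H : set (ocl H -> K) := @theta_Q G K H @` Delta_ker H.
Arguments AP_ker : clear implicits.

Definition Delta_tor H := quotient_mod (Delta_tf W i H) (Delta_ker H).
Arguments Delta_tor : clear implicits.

Definition AP_tor H := quotient_mod (AP_tf W i H) (AP_ker H).
Arguments AP_tor : clear implicits.

Definition pi_Delta H : Delta_tf W i H -> Delta_tor H :=
  @pi_mod _ _ _ (Delta_ker H).

Definition pi_AP H : AP_tf W i H -> AP_tor H :=
  @pi_mod _ _ _ (AP_ker H).

Definition Delta_dflt H : Delta_tor H := pi_Delta (tau_tf W i (cfun_cst H 0)).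

Definition AP_dflt H : AP_tor H := pi_AP (theta_tf (tau_tf W i (cfun_cst H 0))).

(* W_H(R) is the quotient of W_H(R') by W_H(ker rho), with projection W_H(rho). *)
Definition tau_tor H : W H R -> Delta_tor H :=
  @induced (W H R') (W H R) _ _ (Delta_dflt H)
    (@cfun_map G H R' R rho) (@pi_Delta H) (@tau_tf G W R' K i H).

Definition theta_tor H : Delta_tor H -> AP_tor H :=
  induced (AP_dflt H) (@pi_Delta H) (@pi_AP H) (@theta_tf G W R' K i H).

Definition Ind_tor U H : Delta_tor U -> Delta_tor H :=
  induced (Delta_dflt H) (@pi_Delta U) (@pi_Delta H) (@Ind_tf G W R' K i U H).

Definition bInd_tor U H : AP_tor U -> AP_tor H :=
  induced (AP_dflt H) (@pi_AP U) (@pi_AP H) (@bInd_tf G W R' K i U H).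

Definition torsion_data : necklace_data W R :=
  @NecklaceData G W R Delta_tor AP_tor
    tau_tor theta_tor Ind_tor bInd_tor.

End TorsionCase.

(* D consists of the rings Delta_H(R) and AP_H(R), H open in G, with their maps,
   built from one choice of rho and of the tensor product with rat. *)
Inductive necklace_rings (G : profiniteGroupType) (W : wb_functor G)
    (R : comNzRingType) : necklace_data W R -> Prop :=
| NecklaceRational :
    contains_rat R ->
    necklace_rings (rational_data W R)
| NecklaceTorsionFree (K : comNzRingType) (i : {rmorphism R -> K}) :
    torsion_free R -> ~ contains_rat R -> is_tensor_rat i ->
    necklace_rings (torsion_free_data W i)
| NecklaceTorsion (R' K : comNzRingType) (rho : {rmorphism R' -> R})
    (i : {rmorphism R' -> K}) :
    ~ torsion_free R -> torsion_free R' -> (forall r, exists r', rho r' = r) ->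
    is_tensor_rat i ->
    necklace_rings (torsion_data W rho i).

(* Main.v *)
(* Send x : ocl H -> K to its marks: the mark of x at an open subgroup V is the
   sum of x W times the number of V-fixed points of H/W.  Over a Q-algebra marks
   are coordinates, since their table is triangular with nonzero diagonal with
   respect to the index.  In these coordinates tau becomes the family of ghost
   maps, and, because the V-fixed points of H/W fibre over those of H/U for W
   contained in U, Ind from U becomes the sum over the V-fixed cosets gU of the
   marks at g^-1 V g, which is also how v_U acts on ghosts: this is (a).  (b) is
   multiplicativity of the index.  Naturality of v_U carries both to the
   subgroups Delta(R) of Delta(RQ) and to their quotients. *)
Require Import Defs.
From HB Require Import structures.
From mathcomp Require Import all_boot all_order all_algebra.
From mathcomp Require Import finmap.
From mathcomp Require Import boolp classical_sets functions cardinality fsbigop.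
From mathcomp Require Import topology.
Import Defs.

Set Implicit Arguments.
Unset Strict Implicit.
Unset Printing Implicit Defensive.

Import GRing.Theory Num.Theory.
Local Open Scope classical_set_scope.
Local Open Scope ring_scope.

(** * Finite sums over sets and cardinalities *)

Lemma card_fset_set_sum (T : choiceType) (A : set T) :
  #|` fset_set A|%fset = \sum_(i \in A) 1%N.
Proof.
rewrite card_fset_sum1.
rewrite (_ : finite_support _ _ _ = fset_set A)//.
by rewrite /finite_support unlock setIidl.
Qed.

Lemma card_fset_set_bij (T S : choiceType) (A : set T) (B : set S) (f : T -> S) :
  set_bij A B f -> #|` fset_set A|%fset = #|` fset_set B|%fset.
Proof. by move=> fbij; rewrite !card_fset_set_sum (reindex_fsbig f A B). Qed.

(** After the two sums are exchanged, each [i] meets the inner condition only at [j = f i]. *)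
Lemma fsbig_fiber (R : nmodType) (I J : choiceType) (A : set I) (B : set J)
    (f : I -> J) (F : I -> R) :
  finite_set A -> finite_set B -> (forall i, A i -> B (f i)) ->
  \sum_(i \in A) F i = \sum_(j \in B) \sum_(i \in A `&` [set i | f i = j]) F i.
Proof.
move=> Afin Bfin AB.
under [RHS]eq_fsbigr do rewrite fsbig_mkcondr.
rewrite exchange_fsbig//; apply: eq_fsbigr => i /set_mem Ai.
rewrite (fsbigD1 (f i))//=; last exact: AB.
rewrite mem_set//= fsbig1 ?addr0// => j [_ /= /eqP].
by rewrite eq_sym => fij; rewrite memNset//= => /eqP; apply/negP.
Qed.

Lemma mulrn_fsumr (R : nmodType) (I : choiceType) (A : set I) (F : I -> nat) (x : R) :
  finite_set A -> x *+ (\sum_(i \in A) F i) = \sum_(i \in A) x *+ F i.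
Proof. by move=> Afin; rewrite !fsbig_finite// -sumrMnr. Qed.

Lemma mulrn_fsuml (R : nmodType) (I : choiceType) (A : set I) (F : I -> R) n :
  finite_set A -> (\sum_(i \in A) F i) *+ n = \sum_(i \in A) F i *+ n.
Proof. by move=> Afin; rewrite !fsbig_finite// -sumrMnl. Qed.

(** * Conjugates and left cosets of open subgroups *)

Section Cosets.
Variable G : profiniteGroupType.
Implicit Types (V W U : opensubgroup G) (A H : set G) (g h x : G).

Lemma conjsetE A g x : conjset A g x = A (x ^ g^-1)%g.
Proof.
apply/propext; split=> [[w Aw <-]|Ax]; first by rewrite conjgK.
by exists (x ^ g^-1)%g; rewrite ?conjgKV.
Qed.

Lemma conjset1 A : conjset A 1%g = A.
Proof. by apply/funext => x; rewrite conjsetE invg1 conjg1. Qed.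

Lemma conjsetM A g h : conjset A (g * h)%g = conjset (conjset A g) h.
Proof. by apply/funext => x; rewrite !conjsetE invgM conjgM. Qed.

Lemma conjsetK A g : conjset (conjset A g) g^-1%g = A.
Proof. by rewrite -conjsetM mulgV conjset1. Qed.

Lemma conjsetVK A g : conjset (conjset A g^-1%g) g = A.
Proof. by rewrite -conjsetM mulVg conjset1. Qed.

Lemma conjsetS A B g : A `<=` B -> conjset A g `<=` conjset B g.
Proof. by move=> AB x; rewrite !conjsetE; exact: AB. Qed.

Lemma sub_conjset A B g : (A `<=` conjset B g) = (conjset A g^-1%g `<=` B).
Proof.
apply/propext; split=> [/(@conjsetS _ _ g^-1%g)|/(@conjsetS _ _ g)].
  by rewrite conjsetK.
by rewrite conjsetVK.
Qed.

Lemma conjset_id V g : (V : set G) g -> conjset V g = V.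
Proof.
move=> Vg; apply/funext => x; apply/propext; rewrite conjsetE; split=> Vx.
  rewrite -(conjgKV g x) [(_ ^ g)%g]conjgE; apply: opensubgroupM.
    exact: opensubgroupV.
  by apply: opensubgroupM.
rewrite conjgE invgK; do 2 apply: opensubgroupM => //; exact: opensubgroupV.
Qed.

Lemma lmulg_continuous g : continuous (fun x : G => g * x)%g.
Proof.
move=> x; apply: (@continuous_comp _ _ _ (fun y => (g, y))
  (fun xy => xy.1 * xy.2)%g); last exact: mulg_continuous.
by apply: cvg_pair; [exact: cvg_cst|exact: cvg_id].
Qed.

Lemma rmulg_continuous g : continuous (fun x : G => x * g)%g.
Proof.
move=> x; apply: (@continuous_comp _ _ _ (fun y => (y, g))
  (fun xy => xy.1 * xy.2)%g); last exact: mulg_continuous.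
by apply: cvg_pair; [exact: cvg_id|exact: cvg_cst].
Qed.

Lemma conj_open V g : open (conjset V g).
Proof.
rewrite (_ : conjset V g = (fun x => x ^ g^-1)%g @^-1` V); last first.
  by apply/funext => x; rewrite conjsetE.
apply: open_comp (@opensubgroup_open _ V); move=> x _.
apply: (@continuous_comp _ _ _ (fun y => y * g^-1)%g (fun y => g^-1^-1 * y)%g).
  exact: rmulg_continuous.
exact: lmulg_continuous.
Qed.

Lemma conj1_mem V g : conjset V g 1%g.
Proof. by rewrite conjsetE conj1g; exact: opensubgroup1. Qed.

Lemma conjM_mem V g x y : conjset V g x -> conjset V g y -> conjset V g (x * y)%g.
Proof. by rewrite !conjsetE conjMg; exact: opensubgroupM. Qed.

Lemma conjV_mem V g x : conjset V g x -> conjset V g x^-1%g.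
Proof. by rewrite !conjsetE conjVg; exact: opensubgroupV. Qed.

(** Makes results on open subgroups available for [conjset V g], which is its underlying set by
    computation. *)
Definition conj_opensubgroup V g : opensubgroup G :=
  OpenSubgroup (@conj_open V g) (conj1_mem V g)
    (@conjM_mem V g) (@conjV_mem V g).

Definition lcoset A g : set G := [set (g * a)%g | a in A].

Lemma lcosetE A g x : lcoset A g x = A (g^-1 * x)%g.
Proof.
apply/propext; split=> [[w Aw <-]|Ax]; first by rewrite mulKg.
by exists (g^-1 * x)%g; rewrite ?mulVKg.
Qed.

Lemma lcosetM A g h : lcoset A (g * h)%g = lcoset (lcoset A h) g.
Proof. by apply/funext => x; rewrite !lcosetE invgM mulgA. Qed.

Lemma lcoset_refl V g : lcoset V g g.
Proof. by rewrite lcosetE mulVg; exact: opensubgroup1. Qed.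

Lemma lcoset_eq V g h : lcoset V g h -> lcoset V g = lcoset V h.
Proof.
rewrite lcosetE => Vgh; apply/funext => x; rewrite !lcosetE.
apply/propext; split=> Vx.
  rewrite (_ : (h^-1 * x = (g^-1 * h)^-1 * (g^-1 * x))%g).
    by apply: opensubgroupM => //; exact: opensubgroupV.
  by rewrite invgM invgK -mulgA mulVKg.
rewrite (_ : (g^-1 * x = (g^-1 * h) * (h^-1 * x))%g); first exact: opensubgroupM.
by rewrite -mulgA mulVKg.
Qed.

Lemma lcoset_id V g : (V : set G) g -> lcoset V g = V.
Proof.
move=> Vg; transitivity (lcoset V 1%g).
  by apply: lcoset_eq; rewrite lcosetE mulg1; exact: opensubgroupV.
by apply/funext => x; rewrite lcosetE invg1 mul1g.
Qed.

Lemma lcosetI A B g : lcoset A g = lcoset B g -> A = B.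
Proof.
by move=> AB; apply/funext => x; have := congr1 (@^~ (g * x)%g) AB;
  rewrite !lcosetE mulKg.
Qed.

Lemma rcosetI A B g :
  [set (x * g)%g | x in A] = [set (x * g)%g | x in B] -> A = B.
Proof.
have sub A' B' : [set (x * g)%g | x in A'] = [set (x * g)%g | x in B'] -> A' `<=` B'.
  move=> AB x Ax; have : [set (y * g)%g | y in A'] (x * g)%g by exists x.
  by rewrite AB => -[y By /mulIg <-].
by move=> AB; apply/seteqP; split; apply: sub.
Qed.

(** Since gAh = gh(h^-1 A h), right translation by [h] turns cosets of [A] into cosets of its
    conjugate. *)
Lemma lcoset_conj A g h :
  [set (x * h)%g | x in lcoset A g] = lcoset (conjset A h) (g * h)%g.
Proof.
apply/funext => x; rewrite lcosetE conjsetE; apply/propext; split.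
  move=> [_ [a Aa <-] <-].
  by rewrite conjgE invgK invgM -!mulgA mulVKg mulKg mulgV mulg1.
move=> Ax; exists (x * h^-1)%g; last by rewrite mulgVK.
by rewrite lcosetE; move: Ax; rewrite conjgE invgK invgM -!mulgA mulVKg.
Qed.

Lemma lcoset_open V g : open (lcoset V g).
Proof.
rewrite (_ : lcoset V g = (fun x => g^-1 * x)%g @^-1` V); last first.
  by apply/funext => x; rewrite lcosetE.
apply: open_comp (@opensubgroup_open _ V); move=> x _.
exact: lmulg_continuous.
Qed.

(** All a in [A] fix hW exactly when every ah lies in hW, that is, when h^-1 A h lies in [W]. *)
Lemma fixed_lcosetsP A H W C :
  fixed_lcosets A H W C <->
  exists2 h, H h & C = lcoset W h /\ conjset A h `<=` W.
Proof.
split=> [[[h Hh <-] Afix]|[h Hh [-> AW]]].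
  exists h => //; split=> // x; rewrite conjsetE => /Afix Wfix.
  have : lcoset W h ((x ^ h^-1) * h)%g.
    by rewrite /lcoset -Wfix; exists h => //; exact: lcoset_refl.
  by rewrite lcosetE conjgE invgK -!mulgA mulVg mulg1 mulKg.
split; first by exists h.
move=> a Aa; rewrite -[LHS]/(lcoset _ a) -lcosetM; apply/esym/lcoset_eq.
rewrite lcosetE mulgA; apply: AW.
by rewrite conjsetE conjgE invgK !mulgA mulgV mul1g mulgK.
Qed.

(** The representative chosen by [xget] differs from any other by an element of [W], and conjugation
    by such an element preserves [W]. *)
Lemma fixed_lcosets_xget A (H W : opensubgroup G) C :
    W `<=` H -> fixed_lcosets A H W C ->
  [/\ (H : set G) (xget 1%g C), C = lcoset W (xget 1%g C)
    & conjset A (xget 1%g C) `<=` W].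
Proof.
move=> WH /fixed_lcosetsP[h Hh [-> AW]].
have := xgetI 1%g (@lcoset_refl W h); set g := xget _ _ => hg.
have Wg : (W : set G) (h^-1 * g)%g by rewrite -lcosetE.
have hgE : g = (h * (h^-1 * g))%g by rewrite mulVKg.
split; [by rewrite hgE; apply: opensubgroupM => //; exact: WH|exact: lcoset_eq|].
rewrite hgE conjsetM -[X in _ `<=` X](conjset_id Wg); exact: conjsetS.
Qed.

(** The cosets of [W] are open and cover the compact group, and two cosets that meet coincide. *)
Lemma finite_lcosets H W : finite_set (lcosets H W).
Proof.
(* [compact_cover] is applied to a pointed space, with 1 as the point. *)
pose pG : ptopologicalType :=
  HB.pack_for ptopologicalType G (isPointed.Build G 1%g).
have : @compact pG [set: pG] := @profinite_compact G.
rewrite compact_cover => Gcompact.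
have [|x _|D _ Dcover] := Gcompact G setT (fun g => lcoset W g).
- by move=> g _; exact: lcoset_open.
- by exists x => //; exact: lcoset_refl.
apply: (@sub_finite_set _ _ ((fun g => lcoset W g) @` [set` D])); last first.
  by apply: finite_image; exact: finite_fset.
move=> _ [h _ <-]; have [g Dg hg] := Dcover h I.
by exists g => //; exact: lcoset_eq.
Qed.

Lemma finite_fixed_lcosets A H W : finite_set (fixed_lcosets A H W).
Proof. by apply: sub_finite_set (finite_lcosets H W) => C []. Qed.

End Cosets.

(** * Numbers of fixed points and indices *)

Section FixedPoints.
Variable G : profiniteGroupType.
Implicit Types (V W U Y H : opensubgroup G) (A : set G) (g h x : G) (C D : set G).

(* The fibre of H/Y -> H/U over the A-fixed point gU is a copy of U/Y with the
   action of A conjugated by g. *)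
Lemma fixed_points_fiber A H U Y : U `<=` H -> Y `<=` U ->
  fixed_points A H Y = \sum_(C \in fixed_lcosets A H U)
    fixed_points (conjset A (xget 1%g C)) U Y.
Proof.
move=> UH YU; have YH : Y `<=` H by apply: subset_trans UH.
rewrite /fixed_points card_fset_set_sum.
(* [f] is the projection H/Y -> H/U, computed on the chosen representative. *)
pose f C : set G := lcoset U (xget 1%g C).
have fE h : f (lcoset Y h) = lcoset U h.
  apply/esym/lcoset_eq; have := xgetI 1%g (lcoset_refl Y h).
  by rewrite !lcosetE => /YU.
rewrite (@fsbig_fiber _ _ _ _ (fixed_lcosets A H U) f); last first.
- move=> C /fixed_lcosetsP[h Hh [-> AY]]; apply/fixed_lcosetsP; exists h => //.
  by rewrite fE; split=> //; apply: subset_trans YU.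
- exact: finite_fixed_lcosets.
- exact: finite_fixed_lcosets.
apply: eq_fsbigr => C /set_mem /(fixed_lcosets_xget UH).
set g := xget _ _ => -[Hg CE AgU].
rewrite -card_fset_set_sum; apply/esym.
apply: (@card_fset_set_bij _ _ _ _ (fun D => [set (g * d)%g | d in D])); split.
- move=> D /fixed_lcosetsP[u Uu [-> AY]].
  rewrite -[X in _ X]/(lcoset _ g) -lcosetM; split; last first.
    by rewrite /= fE CE lcosetM lcoset_id.
  apply/fixed_lcosetsP; exists (g * u)%g; last by rewrite conjsetM.
  by apply: opensubgroupM => //; exact: UH.
- by move=> D D' _ _; exact: lcosetI.
- move=> E [/fixed_lcosetsP[h Hh [-> AY]] /=]; rewrite fE => hC.
  have Ugh : (U : set G) (g^-1 * h)%g by rewrite -lcosetE -CE -hC; exact: lcoset_refl.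
  exists (lcoset Y (g^-1 * h)%g); last first.
    by rewrite -[LHS]/(lcoset _ g) -lcosetM mulVKg.
  apply/fixed_lcosetsP; exists (g^-1 * h)%g => //.
  by rewrite -conjsetM mulVKg.
Qed.

(** Right translation by [h] commutes with the left action of [A], so it matches the fixed
    cosets. *)
Lemma fixed_points_conjr A H W h : (H : set G) h ->
  fixed_points A H (conjset W h) = fixed_points A H W.
Proof.
move=> Hh; apply/esym.
apply: (@card_fset_set_bij _ _ _ _ (fun D => [set (d * h)%g | d in D])); split.
- move=> D /fixed_lcosetsP[u Uu [-> AY]].
  rewrite lcoset_conj; apply/(fixed_lcosetsP A H (conj_opensubgroup W h)).
  exists (u * h)%g; first exact: opensubgroupM.
  by split=> //; rewrite conjsetM; exact: conjsetS.
- by move=> D D' _ _; exact: rcosetI.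
- move=> E /(fixed_lcosetsP A H (conj_opensubgroup W h))[u Uu [-> AY]].
  exists (lcoset W (u * h^-1)%g); last by rewrite lcoset_conj mulgVK.
  apply/fixed_lcosetsP; exists (u * h^-1)%g => //.
    by apply: opensubgroupM => //; exact: opensubgroupV.
  by split=> //; rewrite conjsetM -sub_conjset.
Qed.

Lemma fixed_points_conjl A H W h : (H : set G) h ->
  fixed_points (conjset A h) H W = fixed_points A H W.
Proof.
move=> Hh; apply: (@card_fset_set_bij _ _ _ _ (fun D => lcoset D h)); split.
- move=> D /fixed_lcosetsP[u Uu [-> AY]]; rewrite -lcosetM.
  apply/fixed_lcosetsP; exists (h * u)%g; first exact: opensubgroupM.
  by rewrite conjsetM.
- by move=> D D' _ _; exact: lcosetI.
- move=> E /fixed_lcosetsP[u Uu [-> AY]].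
  exists (lcoset W (h^-1 * u)%g); last by rewrite -lcosetM mulVKg.
  apply/fixed_lcosetsP; exists (h^-1 * u)%g => //.
    by apply: opensubgroupM => //; exact: opensubgroupV.
  by rewrite -conjsetM mulVKg.
Qed.

Lemma fixed_points_eq0 A H W : ~ subconj_in H A W -> fixed_points A H W = 0%N.
Proof.
move=> AW; rewrite /fixed_points (_ : fixed_lcosets _ _ _ = set0).
  by rewrite fset_set0 cardfs0.
rewrite -subset0 => C /fixed_lcosetsP[h Hh [_ AhW]]; apply: AW.
exists h^-1%g; first exact: opensubgroupV.
by rewrite sub_conjset invgK.
Qed.

Lemma fixed_points_gt0 A H W : subconj_in H A W -> (0 < fixed_points A H W)%N.
Proof.
move=> [h Hh AhW]; rewrite /fixed_points cardfs_gt0; apply/fset0Pn.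
exists (lcoset W h^-1%g); rewrite in_fset_set; last exact: finite_fixed_lcosets.
apply/mem_set/fixed_lcosetsP; exists h^-1%g; first exact: opensubgroupV.
by rewrite -sub_conjset.
Qed.

(** Reduces facts about indices to facts about fixed points, those of the trivial subgroup. *)
Lemma indexE H W : index H W = fixed_points [set 1%g] H W.
Proof.
rewrite /index /fixed_points; congr #|` fset_set _|%fset.
apply/seteqP; split=> [C HC|C []//]; split=> // _ ->.
by rewrite -[RHS]image_id; apply: eq_imagel => x _; rewrite mul1g.
Qed.

Lemma index_gt0 H W : (0 < index H W)%N.
Proof.
rewrite indexE; apply: fixed_points_gt0; exists 1%g; first exact: opensubgroup1.
by rewrite conjset1 => _ ->; exact: opensubgroup1.
Qed.

Lemma conjset_set1 g : conjset [set 1%g] g = [set 1%g].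
Proof. by rewrite /conjset image_set1 conj1g. Qed.

(** The fibre formula at the trivial subgroup: its conjugates are trivial, so all fibres of H/Y ->
    H/U have the same size. *)
Lemma index_mul H U Y : U `<=` H -> Y `<=` U ->
  index H Y = (index H U * index U Y)%N.
Proof.
move=> UH YU; rewrite !indexE (fixed_points_fiber _ UH YU).
under eq_fsbigr do rewrite conjset_set1.
have fin := finite_fixed_lcosets [set 1%g] H U.
rewrite [in RHS]/(fixed_points _ H U) card_fset_set_sum !fsbig_finite// big_distrl/=.
by apply: eq_bigr => C _; rewrite mul1n.
Qed.

Lemma index_conj H W h : (H : set G) h -> index H (conjset W h) = index H W.
Proof.
move=> Hh; rewrite indexE -(fixed_points_conjr [set 1%g] W Hh).
exact: (indexE H (conj_opensubgroup W h)).
Qed.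

Lemma index_eq1 H W : W `<=` H -> index H W = 1%N -> (H : set G) = W.
Proof.
move=> WH /eqP/cardfs1P[C HWC]; apply/seteqP; split=> // h Hh.
have Ch g : (H : set G) g -> lcoset W g = C.
  move=> Hg; apply/eqP; rewrite -in_fset1 -HWC in_fset_set; last exact: finite_lcosets.
  by apply/mem_set; exists g.
have := Ch _ (opensubgroup1 H).
by rewrite (lcoset_id (opensubgroup1 W)) -(Ch h Hh) => ->; exact: lcoset_refl.
Qed.

(** Conjugates have equal index, so [conj_index] is the quotient of (H:V) by (H:W), whichever
    conjugate its definition picks. *)
Lemma conj_index_mul H W V : W `<=` H -> V `<=` H -> subconj_in H V W ->
  index H V = (index H W * conj_index H W V)%N.
Proof.
move=> WH VH VW; rewrite /conj_index.
have [|Hh VWh] := @xgetPex _ 1%g [set h | (H : set G) h /\ V `<=` conjset W h].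
  by case: VW => h Hh ?; exists h.
set h := xget _ _ in Hh VWh *; rewrite -(index_conj W Hh).
apply: (@index_mul H (conj_opensubgroup W h) V) => //.
by rewrite -(conjset_id Hh); exact: conjsetS.
Qed.

Lemma conj_index_gt0 H W V : W `<=` H -> V `<=` H -> subconj_in H V W ->
  (0 < conj_index H W V)%N.
Proof.
move=> WH VH VW; have := index_gt0 H V.
by rewrite (conj_index_mul WH VH VW) muln_gt0 => /andP[].
Qed.

(** Both sides multiplied by (H:W) give (H:V). This matches the exponents of the families [M_family]
    with those of [ghost]. *)
Lemma conj_index_fixed H W V C : W `<=` H -> V `<=` H -> fixed_lcosets V H W C ->
  index W (conjset V (xget 1%g C)) = conj_index H W V.
Proof.
move=> WH VH /(fixed_lcosets_xget WH); set g := xget _ _ => -[Hg _ VW].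
apply/eqP; rewrite -(eqn_pmul2l (index_gt0 H W)) -conj_index_mul//; last first.
  by exists g^-1%g; [exact: opensubgroupV|rewrite sub_conjset invgK].
rewrite -(@index_mul H W (conj_opensubgroup V g))//; apply/eqP.
exact: index_conj.
Qed.

Lemma conj_index_id H V : V `<=` H -> conj_index H V V = 1%N.
Proof.
move=> VH; apply/eqP; rewrite -(eqn_pmul2l (index_gt0 H V)) -conj_index_mul//.
  by rewrite muln1.
by exists 1%g; [exact: opensubgroup1|rewrite conjset1].
Qed.

End FixedPoints.

(** * Conjugacy classes of open subgroups and their finiteness *)

Section Classes.
Variable G : profiniteGroupType.

Lemma opensubgroup_eq (U W : opensubgroup G) : (U : set G) = W -> U = W.
Proof.
case: U W => [U o u1 uM uV] [W o' w1 wM wV] /= UW; case: _ / UW in o' w1 wM wV *.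
by congr OpenSubgroup; exact: Prop_irrelevance.
Qed.

Lemma osub_eq (H : opensubgroup G) (V W : osub H) : (V : set G) = W -> V = W.
Proof.
case: V W => [V VH] [W WH] /= /opensubgroup_eq VW; case: _ / VW in WH *.
by congr OSub; exact: Prop_irrelevance.
Qed.

Lemma ocl_eq (H : opensubgroup G) (V W : ocl H) : V = W :> osub H -> V = W.
Proof.
case: V W => [V VH] [W WH] /= VW; case: _ / VW in WH *.
by congr OCl; exact: Prop_irrelevance.
Qed.

Section Conjugacy.
Variable H : opensubgroup G.
Implicit Types (V W : osub H) (U : opensubgroup G).

Lemma conj_in_refl (A : set G) : conj_in H A A.
Proof. by exists 1%g; [exact: opensubgroup1|rewrite conjset1]. Qed.

Lemma conj_in_sym (A B : set G) : conj_in H A B -> conj_in H B A.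
Proof.
move=> [h Hh ->]; exists h^-1%g; first exact: opensubgroupV.
by rewrite conjsetK.
Qed.

Lemma conj_in_trans (A B C : set G) : conj_in H A B -> conj_in H B C -> conj_in H A C.
Proof.
move=> [h Hh ->] [k Hk ->]; exists (k * h)%g; first exact: opensubgroupM.
by rewrite conjsetM.
Qed.

Lemma conj_in_subconj (A B : set G) : conj_in H A B -> subconj_in H A B.
Proof. by move=> [h Hh ->]; exists h. Qed.

Lemma subconj_in_trans (A B C : set G) :
  subconj_in H A B -> subconj_in H B C -> subconj_in H A C.
Proof.
move=> [h Hh AB] [k Hk BC]; exists (k * h)%g; first exact: opensubgroupM.
by rewrite conjsetM; apply: subset_trans AB _; exact: conjsetS.
Qed.

Lemma conj_sub (V : osub H) h : (H : set G) h -> conj_opensubgroup V h `<=` H.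
Proof. by move=> Hh; rewrite -(conjset_id Hh) /=; exact/conjsetS/osub_sub. Qed.

Lemma class_repr_conj V : conj_in H V (class_repr V).
Proof.
by rewrite /class_repr; apply: (@xgetPex _ V [set W : osub H | conj_in H V W]);
  exists V; exact: conj_in_refl.
Qed.

Lemma class_repr_eq V W : conj_in H V W -> class_repr V = class_repr W.
Proof.
move=> VW; rewrite /class_repr.
have -> : [set Y : osub H | conj_in H V Y] = [set Y : osub H | conj_in H W Y].
  apply/seteqP; split=> Y /=; first by apply: conj_in_trans; exact: conj_in_sym.
  exact: conj_in_trans.
(* The two choices are now from the same set, with defaults [V] and [W]; the set contains [W], so
   neither default is returned. *)
rewrite /xget; case: pselect => // -[]; exists W; apply/asboolP; exact: conj_in_refl.
Qed.

Lemma class_reprK V : class_repr (class_repr V) = class_repr V.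
Proof. by apply/esym/class_repr_eq/class_repr_conj. Qed.

Definition class_of V : ocl H := OCl (class_reprK V).

Lemma conj_in_class_of V : conj_in H V (class_of V).
Proof. exact: class_repr_conj. Qed.

Lemma ocl_conj_eq (V W : ocl H) : conj_in H V W -> V = W.
Proof. by move=> /class_repr_eq VW; apply: ocl_eq; rewrite -ocl_repr VW ocl_repr. Qed.

Lemma class_of_conjE V (W : ocl H) : (class_of V = W) <-> conj_in H V W.
Proof.
split=> [<-|VW]; first exact: conj_in_class_of.
by apply: ocl_conj_eq; apply: conj_in_trans VW; exact/conj_in_sym/conj_in_class_of.
Qed.

(** A subgroup containing [U] is a union of left cosets of [U], and there are only finitely many of
    these. *)
Lemma finite_over U : finite_set [set W : osub H | U `<=` W].
Proof.
pose L := fset_set (lcosets setT U).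
have LE C : (C \in L) = (C \in lcosets setT U).
  by rewrite in_fset_set//; exact: finite_lcosets.
(* [f] recovers a subgroup from its set of cosets; a set of cosets whose union is no open subgroup
   of [H] goes to [H]. *)
pose f (X : {fset set G}) := xget (OSub (@subset_refl _ H))
  [set W : osub H | (W : set G) = \bigcup_(C in [set` X]) C].
apply: (@sub_finite_set _ _ (f @` [set` fpowerset L])); last first.
  by apply: finite_image; exact: finite_fset.
move=> W /= UW; pose X := [fset C in L | `[< (C `<=` W)%classic >]]%fset.
have WX : (W : set G) = \bigcup_(C in [set` X]) C.
  apply/seteqP; split=> [x Wx|x [C]]; last first.
    by rewrite /= !inE /= => /andP[_ /asboolP CW] /CW.
  exists (lcoset U x); last exact: lcoset_refl.
  rewrite /= !inE LE; apply/andP; split; first by apply/mem_set; exists x.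
  by apply/asboolP => y [u /UW Wu <-]; exact: opensubgroupM.
exists X.
  by rewrite /= fpowersetE; apply/fsubsetP => C; rewrite !inE => /andP[].
have := @xgetPex _ (OSub (@subset_refl _ H))
  [set W : osub H | (W : set G) = \bigcup_(C in [set` X]) C].
by rewrite -/(f X) => /(_ (ex_intro _ W WX)) /= fX; apply: osub_eq; rewrite fX.
Qed.

(** Each such class has a member that contains [U]. This makes the primed sums finite. *)
Lemma finite_subconj U : finite_set [set W : ocl H | subconj_in H U W].
Proof.
apply: (sub_finite_set _ (finite_image class_of (finite_over U))).
move=> W [h Hh UW]; exists (OSub (@conj_sub W h Hh)) => //.
by apply/class_of_conjE; exists h.
Qed.

(** If the indices were equal, [V] would have index 1 in a conjugate of [W], hence equal it. The
    index thus serves as rank for the triangular systems below. *)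
Lemma index_subconj (V W : ocl H) : subconj_in H V W -> W <> V ->
  (index H W < index H V)%N.
Proof.
move=> VW nVW; rewrite (conj_index_mul (@osub_sub _ _ W) (@osub_sub _ _ V) VW).
rewrite -[X in (X < _)%N]muln1 ltn_pmul2l ?index_gt0//.
have [h Hh VWh] := VW.
(* Comparing two factorisations of (H:V) identifies [conj_index H W V] with the index of [V] in this
   conjugate of [W]. *)
move: (conj_index_mul (@osub_sub _ _ W) (@osub_sub _ _ V) VW).
rewrite -(index_conj W Hh) (@index_mul _ H (conj_opensubgroup W h) V) //;
  last exact: conj_sub.
move=> /eqP; rewrite eqn_pmul2l ?index_gt0// => /eqP <-.
rewrite ltn_neqAle index_gt0 andbT; apply/eqP => /esym.
move=> /(@index_eq1 _ (conj_opensubgroup W h) V VWh) /= WV.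
by apply: nVW; apply/esym/ocl_conj_eq; exists h.
Qed.

End Conjugacy.
End Classes.

(** * Recursion on a rank, and marks *)

Lemma iter_fixpoint (T S : Type) (m : T -> nat) (F : (T -> S) -> T -> S) (x0 : T -> S) :
    (forall x y t, (forall s, (m s < m t)%N -> x s = y s) -> F x t = F y t) ->
  exists x, forall t, F x t = x t.
Proof.
move=> Fm; pose x n := iter n F x0.
(* [F x t] depends only on values of smaller rank, so the value at [t] is final after [m t + 1]
   iterations. *)
have stable n t : (m t < n)%N -> x n.+1 t = x n t.
  elim: n t => // n IHn t; rewrite ltnS => tn.
  by apply: Fm => s st; apply: IHn; exact: leq_trans tn.
have limE n t : (m t < n)%N -> x n t = x (m t).+1 t.
  elim: n => // n IHn; rewrite ltnS leq_eqVlt => /orP[/eqP <-//|tn].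
  by rewrite stable// IHn.
exists (fun t => x (m t).+1 t) => t.
by apply: Fm => s st; exact/esym/limE.
Qed.

Lemma cfun_eq (G : profiniteGroupType) (H : opensubgroup G) A (a b : cfun H A) :
  a =1 b -> a = b.
Proof.
case: a b => [a aP] [b bP] /= /funext ab; case: _ / ab in bP *.
by congr CFun; exact: Prop_irrelevance.
Qed.

Section Marks.
Variables (G : profiniteGroupType) (K : comNzRingType).
Implicit Types (H U : opensubgroup G).

(** [A] is a mere set, as in [ghost], so that [conjset V g] can be inserted directly. *)
Definition mark H (A : set G) (x : ocl H -> K) : K :=
  \sum_(W \in [set W : ocl H | subconj_in H A W]) x W *+ fixed_points A H W.

(** Lets marks prescribed at class representatives be read at every open subgroup of [H]. *)
Lemma mark_conj H (V : osub H) (x : ocl H -> K) : mark (class_of V) x = mark V x.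
Proof.
have [h Hh VE] := conj_in_class_of V.
have cVV := conj_in_subconj (conj_in_sym (conj_in_class_of V)).
have VcV := conj_in_subconj (conj_in_class_of V).
rewrite /mark (_ : [set W : ocl H | subconj_in H (class_of V) W] =
  [set W : ocl H | subconj_in H V W]); last first.
  by apply/seteqP; split=> W; exact: subconj_in_trans.
by apply: eq_fsbigr => W _; rewrite VE fixed_points_conjl.
Qed.

(** If the conjugate of [Y] by [h] contains [V], then [V] fixes the coset h^-1 U, because [Y] lies
    in [U]. *)
Lemma subconj_coverP H U (V : opensubgroup G) (Y : ocl U) : U `<=` H ->
  subconj_in H V Y <-> exists2 C, fixed_lcosets V H U C &
    subconj_in U (conjset V (xget 1%g C)) Y.
Proof.
move=> UH; split=> [[h Hh VY]|[C /(fixed_lcosets_xget UH)[]]].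
  have fixC : fixed_lcosets V H U (lcoset U h^-1%g).
    apply/fixed_lcosetsP; exists h^-1%g; first exact: opensubgroupV.
    by split=> //; rewrite -sub_conjset; apply: subset_trans VY _;
      apply: conjsetS; exact: osub_sub.
  exists (lcoset U h^-1%g) => //.
  have [_ CE _] := fixed_lcosets_xget UH fixC.
  set g := xget _ _ in CE *.
  (* The chosen representative [g] lies in h^-1 U, so hg is in [U]. *)
  exists (h * g)%g; first by rewrite -{1}(invgK h) -lcosetE CE; exact: lcoset_refl.
  by rewrite conjsetM; exact: conjsetS.
set g := xget _ _ => Hg _ _ [u Uu VY].
exists (u * g^-1)%g; last by rewrite conjsetM sub_conjset invgK.
by apply: opensubgroupM; [exact: UH|exact: opensubgroupV].
Qed.

Lemma finite_subconj_over H U (V : opensubgroup G) : U `<=` H ->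
  finite_set [set Y : ocl U | subconj_in H V Y].
Proof.
move=> UH; apply: (@sub_finite_set _ _ (\bigcup_(C in fixed_lcosets V H U)
    [set Y : ocl U | subconj_in U (conjset V (xget 1%g C)) Y])).
  by move=> Y /(subconj_coverP _ _ UH)[C]; exists C.
apply: bigcup_finite; first exact: finite_fixed_lcosets.
by move=> C _; exact: (finite_subconj U (conj_opensubgroup V _)).
Qed.

Lemma finite_conj_in H U (W : ocl H) : U `<=` H ->
  finite_set [set Y : ocl U | conj_in H Y W].
Proof.
move=> UH; apply: sub_finite_set (finite_subconj_over W UH) => Y.
by move=> /= /conj_in_sym/conj_in_subconj.
Qed.

(** Summing over the [H]-classes undoes the grouping made by [Ind_Q]; the fibre formula for H/Y ->
    H/U and an exchange of sums then give the marks on [U]. *)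
Lemma mark_Ind H U (V : opensubgroup G) (x : ocl U -> K) : U `<=` H ->
  mark V (Ind_Q U H x) =
  \sum_(C \in fixed_lcosets V H U) mark (conjset V (xget 1%g C)) x.
Proof.
move=> UH; pose o (Y : ocl U) := @OSub _ H Y (subset_trans (@osub_sub _ _ Y) UH).
pose c Y := class_of (o Y).
pose S := [set Y : ocl U | subconj_in H V Y].
have Sfin : finite_set S by exact: finite_subconj_over.
have cY (Y : ocl U) : conj_in H Y (c Y) by exact: (conj_in_class_of (o Y)).
transitivity (\sum_(Y \in S) x Y *+ fixed_points V H Y).
  rewrite (@fsbig_fiber _ _ _ S [set W : ocl H | subconj_in H V W] c)//; last first.
  - by move=> Y /subconj_in_trans; apply; exact: conj_in_subconj.
  - exact: finite_subconj.
  apply: eq_fsbigr => W /set_mem VW.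
  rewrite mulrn_fsuml; last exact: finite_conj_in.
  have -> : S `&` [set Y | c Y = W] = [set Y : ocl U | conj_in H Y W].
    apply/seteqP; split=> Y; first by case=> _ <-; exact: cY.
    move=> YW; split; last by apply/(class_of_conjE (o Y)).
    by apply: subconj_in_trans VW _; exact/conj_in_subconj/conj_in_sym.
  apply: eq_fsbigr => Y /set_mem /= /conj_in_sym [h Hh WY].
  by rewrite WY fixed_points_conjr.
rewrite /mark.
under eq_fsbigr => Y _.
  rewrite (fixed_points_fiber V UH (@osub_sub _ _ Y)) mulrn_fsumr; last first.
    exact: finite_fixed_lcosets.
  over.
rewrite exchange_fsbig//; last exact: finite_fixed_lcosets.
(* A class [Y] not above the conjugate of [V] contributes no fixed points, so the inner sum is a
   mark on [U]. *)
apply: eq_fsbigr => C /set_mem HC; apply/esym/fsbig_widen.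
  by move=> Y VY; apply/subconj_coverP => //; exists C.
by move=> Y [_ /= nY]; rewrite fixed_points_eq0// mulr0n.
Qed.

Hypothesis Ktf : torsion_free K.

Lemma torsion_free_mulrn n (a b : K) : (0 < n)%N -> a *+ n = b *+ n -> a = b.
Proof.
case: n => // n _ /eqP; rewrite -subr_eq0 -mulrnBl => /eqP/Ktf/eqP.
by rewrite subr_eq0 => /eqP.
Qed.

(* Besides W = V, the V-th equation only involves classes W of smaller index.
   The coefficients depend on V to cover the powers occurring in ghost maps. *)
Lemma mark_triangular H (a b : ocl H -> ocl H -> K) (P : ocl H -> Prop) :
    (forall V W : ocl H, subconj_in H V W -> P W -> a V W = b V W) ->
    (forall V : ocl H, a V V = b V V -> P V) ->
    (forall V : ocl H,
       \sum_(W \in [set W : ocl H | subconj_in H V W]) a V W *+ fixed_points V H W =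
       \sum_(W \in [set W : ocl H | subconj_in H V W]) b V W *+ fixed_points V H W) ->
  forall W, P W.
Proof.
move=> Pab abP sumab W; have [n] := ubnP (index H W); elim: n W => // n IHn V.
rewrite ltnS => Vn; apply: abP; move: (sumab V).
have VV : subconj_in H V V by apply/conj_in_subconj/conj_in_refl.
pose S := [set W : ocl H | subconj_in H V W].
have D (c : ocl H -> K) : \sum_(W \in S) c W *+ fixed_points V H W =
    c V *+ fixed_points V H V + \sum_(W \in S `\ V) c W *+ fixed_points V H W.
  by rewrite (fsbigD1 V)//; exact: finite_subconj.
rewrite !D (@eq_fsbigr _ _ _ _ _ (fun W => b V W *+ fixed_points V H W)).
  by move=> /addIr /torsion_free_mulrn; apply; exact: fixed_points_gt0.
move=> W /set_mem[/= VW nWV]; rewrite Pab//; apply: IHn.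
exact: leq_trans (index_subconj VW nWV) Vn.
Qed.

Lemma mark_inj H (x y : ocl H -> K) :
  (forall V : ocl H, mark V x = mark V y) -> x = y.
Proof.
move=> xy; apply/funext.
by apply: (@mark_triangular H (fun _ => x) (fun _ => y) (fun W => x W = y W)).
Qed.

(** The triangular argument with powers: all exponents are positive, so 0 stays 0, and the diagonal
    exponent is 1. *)
Lemma ghost_eq0 H (a : cfun H K) : (forall V : osub H, ghost V a = 0) ->
  a = cfun_cst H 0.
Proof.
move=> a0; suff aE (V : ocl H) : a V = 0.
  by apply: cfun_eq => V; rewrite (cfun_conj a (conj_in_class_of V)) aE.
apply: (@mark_triangular H (fun V W => a W ^+ conj_index H W V) (fun _ _ => 0)
  (fun W => a W = 0)) V => [V W VW ->|V|V].
- by rewrite expr0n (gtn_eqF (conj_index_gt0 (@osub_sub _ _ W) (@osub_sub _ _ V) VW)).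
- by rewrite (conj_index_id (@osub_sub _ _ V)) expr1.
- by rewrite -/(ghost V a) a0 fsbig1// => W _; rewrite mul0rn.
Qed.

Hypothesis Kdiv : forall n, exists u : K, u *+ n.+1 = 1.

(** The triangular system is solved by recursion on the index, dividing by the diagonal entries. *)
Lemma mark_surj H (c : ocl H -> K) :
  exists x : ocl H -> K, forall V : ocl H, mark V x = c V.
Proof.
have [q qE] := choice Kdiv.
(* [F] solves the [V]-th equation for the coordinate at [V]; [q n] inverts n + 1, hence the
   predecessor. *)
pose F (x : ocl H -> K) (V : ocl H) : K := q (fixed_points V H V).-1 *
  (c V - \sum_(W \in [set W : ocl H | subconj_in H V W] `\ V)
     x W *+ fixed_points V H W).
have [|x Fx] := @iter_fixpoint _ _ (fun V : ocl H => index H V) F (fun=> 0).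
  move=> x y V xy; rewrite /F; congr (_ * (_ - _)).
  apply: eq_fsbigr => W /set_mem[VW nVW]; rewrite xy//; exact: index_subconj.
exists x => V.
have VV : subconj_in H V V by apply/conj_in_subconj/conj_in_refl.
rewrite /mark (fsbigD1 V)//=; last exact: finite_subconj.
rewrite -Fx /F -mulrnAl -{2}(prednK (fixed_points_gt0 VV)) qE mul1r.
by rewrite subrK.
Qed.

(** [M_family] is chosen by [xget], so its equations hold once some solution exists, and [mark_surj]
    provides one. *)
Lemma mark_M_family H (V : osub H) (r : K) : mark V (M_family H r) = r ^+ index H V.
Proof.
have [x xE] := @mark_surj H (fun V => r ^+ index H V).
apply: (@xgetPex _ (fun=> 0) [set M : ocl H -> K | forall U : osub H,
    \sum_(V \in [set V : ocl H | subconj_in H U V]) M V *+ fixed_points U H V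
      = r ^+ index H U] _ V); exists x => U /=.
rewrite -/(mark U x) -mark_conj xE; have [h Hh ->] := conj_in_class_of U.
by rewrite index_conj.
Qed.

(** By [mark_Ind], a class [U] contributes one power of [a U] for each [V]-fixed coset in H/U,
    always with exponent [conj_index H U V]. *)
Lemma mark_tau H (V : osub H) (a : cfun H K) : mark V (tau_Q a) = ghost V a.
Proof.
pose S := [set W : ocl H | subconj_in H V W].
have Sfin : finite_set S by exact: finite_subconj.
have SH (W : ocl H) : W `<=` H by exact: osub_sub.
rewrite /mark /tau_Q.
under eq_fsbigr => W /set_mem VW.
  (* For [W] above [V], a class [U] having a subgroup conjugate to [W] is itself above [V]; the sum
     over all classes shrinks to the finite set [S]. *)
  rewrite -(@fsbig_widen _ _ _ _ S); first last.
  - move=> U [_ /= nVU]; rewrite /Ind_Q fsbig1// => Y YW; case: nVU.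
    apply: subconj_in_trans VW _.
    have := conj_in_subconj (conj_in_sym YW) => /subconj_in_trans; apply.
    by exists 1%g; [exact: opensubgroup1|rewrite conjset1; exact: osub_sub].
  - by [].
  rewrite mulrn_fsuml//.
  over.
rewrite exchange_fsbig// /ghost; apply: eq_fsbigr => U /set_mem VU.
rewrite -/(mark V (Ind_Q U H (M_family U (a U)))) mark_Ind//.
have fin : finite_set (fixed_lcosets V H U) by exact: finite_fixed_lcosets.
rewrite [fixed_points V H U]/(fixed_points _ _ _) card_fset_set_sum mulrn_fsumr//.
apply: eq_fsbigr => C /set_mem VC; rewrite mulr1n.
rewrite -(conj_index_fixed (SH U) (@osub_sub _ _ V) VC).
have [_ _ VgU] := fixed_lcosets_xget (SH U) VC.
exact: (@mark_M_family U (@OSub _ U (conj_opensubgroup V (xget 1%g C)) VgU)).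
Qed.

End Marks.

(** * The maps over an algebra containing the rationals *)

Lemma contains_rat_torsion_free (K : comNzRingType) : contains_rat K -> torsion_free K.
Proof.
move=> [j] n x xn.
rewrite -[x]mulr1 -(rmorph1 j) -(@mulVf _ (n.+1%:R : rat)) ?pnatr_eq0//.
by rewrite rmorphM mulrCA rmorph_nat mulr_natr xn mulr0.
Qed.

Lemma contains_rat_div (K : comNzRingType) : contains_rat K ->
  forall n, exists u : K, u *+ n.+1 = 1.
Proof.
move=> [j] n; exists (j n.+1%:R^-1).
by rewrite -rmorphMn -mulr_natr mulVf ?pnatr_eq0// rmorph1.
Qed.

Lemma is_tensor_rat_contains_rat (R K : comNzRingType) (i : {rmorphism R -> K}) :
  is_tensor_rat i -> contains_rat K.
Proof. by case=> j _; constructor. Qed.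

Lemma ghost_map (G : profiniteGroupType) (H : opensubgroup G) (A B : comNzRingType)
    (h : {rmorphism A -> B}) (V : opensubgroup G) (x : cfun H A) :
  ghost V (cfun_map h x) = h (ghost V x).
Proof.
rewrite /ghost !fsbig_finite ?rmorph_sum; try exact: finite_subconj.
by apply: eq_bigr => W _; rewrite /= rmorphMn rmorphXn.
Qed.

Section AdditiveMaps.
Variables (G : profiniteGroupType) (K : comNzRingType) (U H : opensubgroup G).
Hypothesis UH : U `<=` H.

Lemma markB (V : opensubgroup G) (x y : ocl H -> K) :
  mark V (x \- y) = mark V x - mark V y.
Proof.
rewrite /mark !fsbig_finite; try exact: finite_subconj.
by rewrite -sumrB; apply: eq_bigr => W _; rewrite /= mulrnBl.
Qed.

Lemma Ind_QD (x y : ocl U -> K) :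
  Ind_Q U H (x \+ y) = Ind_Q U H x \+ Ind_Q U H y.
Proof.
apply/funext => W; rewrite /Ind_Q /= fsbig_split//; exact: finite_conj_in.
Qed.

Lemma bInd_QD (x y : ocl U -> K) :
  bInd_Q U H (x \+ y) = bInd_Q U H x \+ bInd_Q U H y.
Proof.
apply/funext => W; rewrite /bInd_Q /= -fsbig_split; last exact: finite_conj_in.
by apply: eq_fsbigr => V _; rewrite mulrnDl.
Qed.

Lemma theta_QD (x y : ocl H -> K) : theta_Q (x \+ y) = theta_Q x \+ theta_Q y.
Proof. by apply/funext => W; rewrite /theta_Q /= mulrnDl. Qed.

Lemma theta_QB (x y : ocl H -> K) : theta_Q (x \- y) = theta_Q x \- theta_Q y.
Proof. by apply/funext => W; rewrite /theta_Q /= mulrnBl. Qed.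

(** Each [V] conjugate to [W] enters with the factor (H:U)(U:V) = (H:V) = (H:W). *)
Lemma bInd_theta_Q (x : ocl U -> K) :
  bInd_Q U H (theta_Q x) = theta_Q (Ind_Q U H x).
Proof.
apply/funext => W; rewrite /theta_Q /Ind_Q /bInd_Q mulrn_fsuml; last first.
  exact: finite_conj_in.
apply: eq_fsbigr => V /set_mem [h Hh VW].
rewrite -mulrnA mulnC -(@index_mul _ H U V)//; last exact: osub_sub.
by rewrite VW index_conj.
Qed.

Hypothesis Krat : contains_rat K.

Lemma Ind_tau_Q (a : cfun U K) (b : cfun H K) :
    (forall V : osub H, ghost V b =
       \sum_(C \in fixed_lcosets V H U) ghost (conjset V (xget 1%g C)) a) ->
  Ind_Q U H (tau_Q a) = tau_Q b.
Proof.
have Ktf := contains_rat_torsion_free Krat.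
have Kdiv := contains_rat_div Krat.
move=> abE; apply: mark_inj => // V; rewrite mark_Ind// mark_tau// abE.
apply: eq_fsbigr => C /set_mem /(fixed_lcosets_xget UH)[_ _ VgU].
exact: (@mark_tau _ _ Kdiv U (@OSub _ U (conj_opensubgroup V (xget 1%g C)) VgU)).
Qed.

End AdditiveMaps.

(** * Zero and subtraction in the Witt-Burnside rings *)

Section WittBurnsideZero.
Variables (G : profiniteGroupType) (W : wb_functor G) (H : opensubgroup G).

Lemma ghostB (A : comNzRingType) (V : osub H) (a b : W H A) :
  ghost V (a - b : W H A) = ghost V (a : cfun H A) - ghost V (b : cfun H A).
Proof. by have [gB _] := @wb_ghost_hom G W H V A; exact: gB. Qed.

Lemma ghost0 (A : comNzRingType) (V : osub H) : ghost V (0 : W H A) = 0 :> A.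
Proof. by rewrite -(subrr (0 : W H A)) ghostB subrr. Qed.

Lemma cfun_mapB (A B : comNzRingType) (h : {rmorphism A -> B}) (a b : W H A) :
  cfun_map h (a - b : W H A) = (cfun_map h a : W H B) - (cfun_map h b : W H B) :> W H B.
Proof. by have [hB _] := @wb_map_hom G W H A B h; exact: hB. Qed.

(** The ring structure is known through its ghost maps; these vanish at its zero and detect the zero
    function. *)
Lemma wb0 (A : comNzRingType) : torsion_free A -> (0 : W H A) = cfun_cst H 0.
Proof.
by move=> Atf; apply: ghost_eq0 => // V; exact: ghost0.
Qed.

Lemma cfun_map0 (A B : comNzRingType) (h : {rmorphism A -> B}) :
  cfun_map h (0 : W H A) = 0 :> W H B.
Proof. by rewrite -(subrr (0 : W H A)) cfun_mapB subrr. Qed.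

(** Ghosts need not separate elements when [B] has torsion, so the zero is carried over from [A]. *)
Lemma wb0_map (A B : comNzRingType) (h : {rmorphism A -> B}) :
  torsion_free A -> (0 : W H B) = cfun_cst H 0.
Proof.
by move=> Atf; rewrite -(cfun_map0 h) wb0//; apply: cfun_eq => V /=; rewrite rmorph0.
Qed.

Lemma tau_inclB (R K : comNzRingType) (i : {rmorphism R -> K}) (a b : W H R) :
  contains_rat K ->
  tau_incl i (a - b : W H R) = tau_incl i a \- tau_incl i b.
Proof.
move=> Krat; have Ktf := contains_rat_torsion_free Krat.
have Kdiv := contains_rat_div Krat.
apply: mark_inj => // V; rewrite markB /tau_incl !mark_tau//.
by rewrite !ghost_map ghostB rmorphB.
Qed.

End WittBurnsideZero.

(** * Induced maps and additive quotients *)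

Lemma induced_eq (X X' Y : Type) (Y' : choiceType) (d : Y')
    (p : X -> X') (q : Y -> Y') (f : X -> Y) :
    (forall x x', p x = p x' -> q (f x) = q (f x')) ->
  forall x, induced d p q f (p x) = q (f x).
Proof.
move=> pq x; have /(@xgetPex _ d) :
    exists y, [set y | forall x', p x' = p x -> y = q (f x')] y.
  by exists (q (f x)) => x' /pq.
exact.
Qed.

Section Quotients.
Variables (X : Type) (K : zmodType) (A N : set (X -> K)).
Hypothesis N0 : N (fun=> 0).
Hypothesis NB : forall n m, N n -> N m -> N (n \- m).

Lemma pi_mod_eq (x y : A) :
  pi_mod N x = pi_mod N y <-> exists2 n, N n & val x = val y \+ n.
Proof.
split=> [/(congr1 val)/= xy|[n Nn xyn]].
  have : coset_mod N x x by exists (fun=> 0) => //; apply/funext => t /=; rewrite addr0.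
  by rewrite xy.
apply: val_inj; apply/seteqP; split=> z [m Nm zE].
  (* This is n + m, expressed through the closure of [N] under differences. *)
  exists (n \- ((fun=> 0) \- m)); first exact/NB/NB.
  by apply/funext => t; rewrite zE xyn /= sub0r opprK addrA.
exists (m \- n); first exact: NB.
by apply/funext => t; rewrite zE xyn /= addrACA subrr addr0.
Qed.

End Quotients.

(** * Torsion-free rings: restriction to the subgroups *)

Section TorsionFree.
Variables (G : profiniteGroupType) (W : wb_functor G) (R K : comNzRingType).
Variables (i : {rmorphism R -> K}) (U : opensubgroup G).
Local Notation T := (whole_group G).
Variable v : forall A : comNzRingType, W U A -> W T A.
Hypothesis vP : is_induction v.
Hypothesis Krat : contains_rat K.

Lemma sub_whole : U `<=` T. Proof. by []. Qed.

Lemma induction_map (A B : comNzRingType) (h : {rmorphism A -> B}) (x : W U A) :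
  v (cfun_map h x : W U B) = cfun_map h (v x).
Proof. by case: vP. Qed.

(** Naturality of [v] along [i] moves the claim to [K]. It also shows that [Ind_Q] maps [Delta_tf]
    into itself. *)
Lemma Ind_tau_incl (a : W U R) : Ind_Q U T (tau_incl i a) = tau_incl i (v a).
Proof.
rewrite /tau_incl -induction_map.
by apply: Ind_tau_Q => // V; case: vP => _ ->.
Qed.

Lemma Ind_tau_tf (a : W U R) : Ind_tf T (tau_tf W i a) = tau_tf W i (v a).
Proof.
apply: val_inj; rewrite /= -Ind_tau_incl insubdK//.
by rewrite Ind_tau_incl; apply/mem_set; exists (v a).
Qed.

Lemma tau_tfP (H : opensubgroup G) (x : Delta_tf W i H) : exists a, x = tau_tf W i a.
Proof. by case: x => x xP; case: (set_mem xP) => a _ ax; exists a; apply: val_inj. Qed.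

Lemma theta_tfP (H : opensubgroup G) (x : AP_tf W i H) : exists y, x = theta_tf y.
Proof.
case: x => x xP; case: (set_mem xP) => y yP yx.
by exists (exist _ y (mem_set yP)); apply: val_inj.
Qed.

Lemma val_Ind_tf (x : Delta_tf W i U) : val (Ind_tf T x) = Ind_Q U T (val x).
Proof. by have [a ->] := tau_tfP x; rewrite Ind_tau_tf /= Ind_tau_incl. Qed.

Lemma bInd_theta_tf (x : Delta_tf W i U) :
  bInd_tf T (theta_tf x) = theta_tf (Ind_tf T x).
Proof.
apply: val_inj; rewrite /= val_Ind_tf -bInd_theta_Q// insubdK//.
rewrite bInd_theta_Q// -val_Ind_tf; apply/mem_set.
by exists (val (Ind_tf T x)) => //; exact: set_valP.
Qed.

Lemma val_bInd_tf (x : AP_tf W i U) : val (bInd_tf T x) = bInd_Q U T (val x).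
Proof.
by have [y ->] := theta_tfP x; rewrite bInd_theta_tf /= val_Ind_tf bInd_theta_Q.
Qed.

End TorsionFree.

(** * Rings with torsion: passage to the quotients *)

Section Torsion.
Variables (G : profiniteGroupType) (W : wb_functor G) (R R' K : comNzRingType).
Variables (rho : {rmorphism R' -> R}) (i : {rmorphism R' -> K}).
Hypothesis tfR' : torsion_free R'.
Hypothesis rho_surj : forall r, exists r', rho r' = r.
Hypothesis Krat : contains_rat K.

Section OneGroup.
Variable H : opensubgroup G.

(** Presents the ideal as the kernel of a ring homomorphism, whence its closure under
    subtraction. *)
Lemma wb_idealP (a : W H R') :
  wb_ideal (W:=W) (ker_rho rho) (H:=H) a <-> cfun_map rho a = 0 :> W H R.
Proof.
rewrite (wb0_map _ _ rho)//; split=> [aI|/(congr1 (fun b : cfun H R => cfun_val b)) aE V].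
  by apply: cfun_eq => V; exact: aI.
exact: (congr1 (fun f : osub H -> R => f V) aE).
Qed.

Lemma wb_idealB (a b : W H R') : wb_ideal (ker_rho rho) a ->
  wb_ideal (ker_rho rho) b -> wb_ideal (ker_rho rho) (a - b).
Proof.
by move=> /wb_idealP a0 /wb_idealP b0; apply/wb_idealP; rewrite cfun_mapB a0 b0 subrr.
Qed.

Lemma tau_incl0 : tau_incl i (0 : W H R') = fun=> 0.
Proof.
by rewrite -(subrr (0 : W H R')) tau_inclB//; apply/funext => V; exact: subrr.
Qed.

Lemma Delta_ker0 : @Delta_ker G W R R' K rho i H (fun=> 0).
Proof.
exists (0 : W H R'); last exact: tau_incl0.
by apply/wb_idealP; exact: cfun_map0.
Qed.

Lemma Delta_kerB n m : @Delta_ker G W R R' K rho i H n ->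
  @Delta_ker G W R R' K rho i H m ->
  @Delta_ker G W R R' K rho i H (n \- m).
Proof.
move=> [a aI <-] [b bI <-]; exists (a - b : W H R'); first exact: wb_idealB.
exact: tau_inclB.
Qed.

Lemma AP_ker0 : @AP_ker G W R R' K rho i H (fun=> 0).
Proof.
exists (fun=> 0); first exact: Delta_ker0.
by apply/funext => V; rewrite /theta_Q mul0rn.
Qed.

Lemma AP_kerB n m : @AP_ker G W R R' K rho i H n -> @AP_ker G W R R' K rho i H m ->
  @AP_ker G W R R' K rho i H (n \- m).
Proof.
move=> [a aI <-] [b bI <-]; exists (a \- b); first exact: Delta_kerB.
exact: theta_QB.
Qed.

Lemma tau_tor_map (a : W H R') :
  tau_tor rho i (cfun_map rho a : W H R) = pi_Delta rho (tau_tf W i a).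
Proof.
rewrite /tau_tor induced_eq// => b c bc.
apply/pi_mod_eq; [exact: Delta_ker0|exact: Delta_kerB|].
(* Two lifts of one element differ by an element of the kernel, and [tau_incl] is additive. *)
exists (tau_incl i (b - c : W H R')).
  exists (b - c : W H R') => //; apply/wb_idealP; rewrite cfun_mapB.
  by apply/eqP; rewrite subr_eq0; apply/eqP.
by rewrite tau_inclB//; apply/funext => V /=; rewrite addrC subrK.
Qed.

Lemma theta_tor_pi (x : Delta_tf W i H) :
  theta_tor (pi_Delta rho x) = pi_AP rho (theta_tf x).
Proof.
rewrite /theta_tor induced_eq// => y z.
move=> /(pi_mod_eq Delta_ker0 Delta_kerB)[n nker yzn].
apply/(pi_mod_eq AP_ker0 AP_kerB); exists (theta_Q n); first by exists n.
by rewrite /= yzn theta_QD.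
Qed.

Lemma cfun_map_surj (c : W H R) : exists a : W H R', c = cfun_map rho a.
Proof.
have [s sE] := choice rho_surj; exists (cfun_map s c : cfun H R').
by apply: cfun_eq => V /=; rewrite sE.
Qed.

Lemma pi_Delta_surj (x : @Delta_tor G W R R' K rho i H) : exists y, x = pi_Delta rho y.
Proof.
by case: x => x xP; case: (set_mem xP) => y _ yx; exists y; apply: val_inj.
Qed.

End OneGroup.

Variable U : opensubgroup G.
Local Notation T := (whole_group G).
Variable v : forall A : comNzRingType, W U A -> W T A.
Hypothesis vP : is_induction v.

(** Read off from the ghosts of [v 0], which determine a zero over the torsion-free [R']. *)
Lemma induction0 : v (0 : W U R') = 0.
Proof.
rewrite (wb0 _ T)//; apply: ghost_eq0 => // V; case: vP => _ ->.
apply: fsbig1 => C /(fixed_lcosets_xget (@sub_whole G U))[_ _ VgU].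
exact: (ghost0 W R' (@OSub _ U (conj_opensubgroup V (xget 1%g C)) VgU)).
Qed.

Lemma Ind_Delta_ker n : @Delta_ker G W R R' K rho i U n ->
  @Delta_ker G W R R' K rho i T (Ind_Q U T n).
Proof.
move=> [a /wb_idealP aI <-]; rewrite (Ind_tau_incl i vP Krat).
exists (v a) => //; apply/wb_idealP; rewrite -(induction_map vP) aI.
(* [R] may have torsion, so its zero is written as the image of the zero over [R'], where
   [induction0] applies. *)
by rewrite -(@cfun_map0 _ W U _ _ rho) (induction_map vP) induction0 cfun_map0.
Qed.

Lemma Ind_tor_pi (x : Delta_tf W i U) :
  Ind_tor T (pi_Delta rho x) = pi_Delta rho (Ind_tf T x).
Proof.
rewrite /Ind_tor induced_eq// => y z.
move=> /(pi_mod_eq (@Delta_ker0 U) (@Delta_kerB U))[n nker yzn].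
apply/(pi_mod_eq (@Delta_ker0 T) (@Delta_kerB T)); exists (Ind_Q U T n).
  exact: Ind_Delta_ker.
by rewrite !(val_Ind_tf vP Krat) yzn Ind_QD.
Qed.

Lemma bInd_tor_pi (x : AP_tf W i U) :
  bInd_tor T (pi_AP rho x) = pi_AP rho (bInd_tf T x).
Proof.
rewrite /bInd_tor induced_eq// => y z.
move=> /(pi_mod_eq (@AP_ker0 U) (@AP_kerB U))[_ [n nker <-] yzn].
(* The witness is [bInd_Q] applied to [theta_Q n], in the form that shows it to lie in [AP_ker]. *)
apply/(pi_mod_eq (@AP_ker0 T) (@AP_kerB T)); exists (theta_Q (Ind_Q U T n)).
  by exists (Ind_Q U T n) => //; exact: Ind_Delta_ker.
by rewrite !(val_bInd_tf vP Krat) yzn bInd_QD// bInd_theta_Q.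
Qed.

End Torsion.

(** * The three identities in the three cases *)

Theorem proposition5p1 (G : profiniteGroupType) (W : wb_functor G)
    (R : comNzRingType) (D : necklace_data W R) (hD : necklace_rings D)
    (U : opensubgroup G)
    (v : forall A : comNzRingType, W U A -> W (whole_group G) A)
    (hv : is_induction v) :
  [/\ Ind D U (whole_group G) \o tau D U = tau D (whole_group G) \o v R,
      bInd D U (whole_group G) \o theta D U =
        theta D (whole_group G) \o Ind D U (whole_group G)
    & bInd D U (whole_group G) \o gamma D U = gamma D (whole_group G) \o v R].
Proof.
(* Since [gamma] is [theta] after [tau], (c) follows by pasting (a) and (b). *)
suff [ab bb] : Ind D U (whole_group G) \o tau D U = tau D (whole_group G) \o v R /\
    bInd D U (whole_group G) \o theta D U =
      theta D (whole_group G) \o Ind D U (whole_group G).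
  split=> //; rewrite /gamma compA bb -compA ab; exact: compA.
case: D / hD => [Rrat|K i Rtf nRrat /is_tensor_rat_contains_rat Krat|
    R' K rho i nRtf R'tf rho_surj /is_tensor_rat_contains_rat Krat].
- split; apply/funext => x /=; last exact: bInd_theta_Q.
  by apply: Ind_tau_Q => // V; case: hv => _ ->.
- split; apply/funext => x /=; first exact: Ind_tau_tf.
  exact: bInd_theta_tf hv Krat _.
(* Elements are lifted along [rho] and [pi_Delta], which reduces both identities to those over
   [R']. *)
- split; apply/funext => x /=.
    have [a ->] := cfun_map_surj rho_surj x.
    rewrite (induction_map hv) !tau_tor_map// (Ind_tor_pi rho R'tf Krat hv).
    by rewrite (Ind_tau_tf i hv Krat).
  have [y ->] := pi_Delta_surj x.
  rewrite theta_tor_pi// (Ind_tor_pi rho R'tf Krat hv) theta_tor_pi//.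
  by rewrite (bInd_tor_pi rho R'tf Krat hv) (bInd_theta_tf hv Krat).
Qed.
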